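(* Let $r$ be a positive integer and let $\boldsymbol{\lambda}=(\lambda_1,\ldots,\lambda_r)$ be any partition of length at most $r$. Then $$z\,\Gamma_r^\vee(z)\Delta_{(\lambda_1,\ldots,\lambda_r)}(H_r)=\left|\begin{array}{cccc}z^{-\lambda_1}&z^{1-\lambda_2}&\cdots&z^{r-1-\lambda_r}\\ h_{\lambda_1+1}&h_{\lambda_2}&\cdots&h_{\lambda_r-r+2}\\ \vdots&\vdots&\ddots&\vdots\\ h_{\lambda_1+r-1}&h_{\lambda_2+r-2}&\cdots&h_{\lambda_r}\end{array}\right|+(-1)^r z^r\,\Delta_{(\lambda_1+1,\ldots,\lambda_r+1)}(H_r),$$ where the $(1,j)$ entry of the determinant is $z^{j-1-\lambda_j}$ and, for $2\le i\le r$, the $(i,j)$ entry is $h_{\lambda_j-j+i}$, with $h_n=0$ for $n<0$.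
   Context: Let $r\ge1$ be an integer. $B_r=\mathbb{Q}[e_1,\dots,e_r]$ is a polynomial ring; $e_0=1$ and $e_i=0$ for $i>r$. $E_r(t)=1+\sum_{i=1}^r(-1)^ie_it^i$, and $H_r=(h_n)_{n\in\mathbb{Z}}$ is defined by $\sum_{n\in\mathbb{Z}}h_nt^n=1/E_r(t)$ in $B_r[[t]]$ (so $h_n=0$ for $n<0$, $h_0=1$). $\mathcal{P}_r$ is the set of partitions $\boldsymbol{\lambda}=(\lambda_1\ge\dots\ge\lambda_r\ge0)$ of length at most $r$, and $\Delta_{\boldsymbol{\lambda}}(H_r)=\det(h_{\lambda_j-j+i})_{1\le i,j\le r}$. It is known that $(\Delta_{\boldsymbol{\lambda}}(H_r))_{\boldsymbol{\lambda}\in\mathcal{P}_r}$ is a $\mathbb{Q}$-basis of $B_r$. For $j\in\mathbb{Z}$ let $u_j=\sum_{n\ge0}h_{n+j}\frac{t^n}{n!}\in B_r[[t]]$ (linearly independent over $\mathbb{Q}$). Semi-infinite exterior monomials $u_{i_0}\wedge u_{i_1}\wedge\cdots$ (with $i_{m+1}=i_m-1$ for all large $m$) are formal symbols over $\mathbb{Q}$, alternating in their entries. Put $\Phi^r_{i,\boldsymbol{\lambda}}=u_{i+\lambda_1}\wedge u_{i-1+\lambda_2}\wedge\cdots\wedge u_{i-r+1+\lambda_r}\wedge u_{i-r}\wedge u_{i-r-1}\wedge\cdots$, $\Phi^r_0=\Phi^r_{0,(0)}$. Contraction with the dual vector $u_i^\vee$ ($u_i^\vee(u_j)=\delta_{ij}$)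 is $u_i^\vee\lrcorner(u_{i_0}\wedge u_{i_1}\wedge\cdots)=\sum_{m\ge0}(-1)^m\delta_{i,i_m}\,u_{i_0}\wedge\cdots\wedge\widehat{u_{i_m}}\wedge\cdots$ (hat means omitted). For $\phi=\sum_{n\ge0}a_n\frac{t^n}{n!}\in B_r[[t]]$ and $k\in\mathbb{N}$ let $U_k(\phi)=a_k+\sum_{i\ge1}(-1)^ie_ia_{k-i}$, where $a_j=0$ for $j<0$; then $\phi=\sum_{i\ge0}U_i(\phi)u_{-i}$. For a monomial $\alpha=u_{i_0}\wedge u_{i_1}\wedge\cdots$ with $i_m=-m$ for all $m\ge k$, put $[\alpha]=(\alpha\otimes_{\mathbb{Q}}1_{B_r})/\Phi^r_0=\det\big(U_a(u_{i_b})\big)_{0\le a,b\le k-1}\in B_r$ (independent of $k$; this is the result of expanding each $u_{i_b}$ $B_r$-linearly in the $u_{-a}$, $a\ge0$). Extend $[\cdot]$ $\mathbb{Q}$-linearly. The vertex operator $\Gamma^\vee_r(z)$ is the $\mathbb{Q}$-linear map on $B_r$ with $\Gamma^\vee_r(z)\Delta_{\boldsymbol{\lambda}}(H_r)=\sum_{i\in\mathbb{Z}}[u_i^\vee\lrcorner\Phi^r_{1,\boldsymbol{\lambda}}]\,z^{-i}$ for $\boldsymbol{\lambda}\in\mathcal{P}_r$. *)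

(* Defs.v *)
From HB Require Import structures.
From mathcomp Require Import all_boot all_order all_algebra.
From mathcomp.multinomials Require Import mpoly.
From mathcomp Require Import zify.

Set Implicit Arguments.
Unset Strict Implicit.
Unset Printing Implicit Defensive.

Import Order.TTheory GRing.Theory Num.Theory.
Local Open Scope ring_scope.

(* B_r = Q[e_1, ..., e_r]; the variable e_i is 'X_(i-1). *)
Notation "'B_ r" := {mpoly rat[r]} (at level 8, r at level 2, format "''B_' r").

Definition e (r k : nat) : 'B_r :=
  if k is k'.+1 then
    if (insub k' : option 'I_r) is Some i then 'X_i else 0
  else 1.

(* E_r(t) *)
Definition E (r : nat) : {poly 'B_r} := \poly_(i < r.+1) ((-1) ^+ i * e r i).

(* [:: h_0; ...; h_(n-1)], computed from E_r(t) * (\sum_n h_n t^n) = 1, that is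
   h_0 = 1 and h_m = - \sum_(1 <= i <= m) E_i h_(m-i) for m > 0. *)
Fixpoint hseq (r n : nat) : seq 'B_r :=
  if n is m.+1 then
    rcons (hseq r m)
      (if m == 0%N then 1
       else - \sum_(1 <= i < m.+1) (E r)`_i * (hseq r m)`_(m - i))
  else [::].

Definition h (r : nat) (n : int) : 'B_r :=
  if n is Posz m then (hseq r m.+1)`_m else 0.

Lemma size_hseq r n : size (hseq r n) = n.
Proof. by elim: n => //= n IHn; rewrite size_rcons IHn. Qed.

Lemma nth_hseq r n m : (m < n)%N -> (hseq r n)`_m = h r m.
Proof.
elim: n => [//|n IHn]; rewrite ltnS leq_eqVlt => /predU1P[-> // | lt_mn].
by rewrite [hseq r n.+1]/= nth_rcons size_hseq lt_mn IHn.
Qed.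

(* The sequence h is indeed the inverse of E_r(t) in B_r[[t]]. *)
Lemma E_mul_h r n :
  \sum_(i < n.+1) (E r)`_i * h r (n - i)%N = (n == 0%N)%:R.
Proof.
have E0 : (E r)`_0 = 1 by rewrite coef_poly /= mul1r.
have hS m : h r m.+1 = - \sum_(i < m.+1) (E r)`_(i.+1) * h r (m - i)%N.
  rewrite {1}/h [hseq r _]/= nth_rcons size_rcons size_hseq ltnn eqxx.
  congr (- _); rewrite big_add1 big_mkord; apply: eq_bigr => i _.
  by rewrite subSS -[rcons _ _]/(hseq r m.+1) nth_hseq // ltnS leq_subr.
case: n => [|n]; first by rewrite big_ord1 E0 mul1r.
by rewrite big_ord_recl E0 mul1r subn0 hS addNr.
Qed.

(* partitions of length at most r *)
Record bpartition (r : nat) := BPartition {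
  part :> r.-tuple nat;
  part_sorted : sorted geq part
}.

Lemma shift_sorted r (lam : bpartition r) : sorted geq [tuple of map S lam].
Proof. by rewrite sorted_map; exact: part_sorted. Qed.

(* (lambda_1 + 1, ..., lambda_r + 1) *)
Definition shift r (lam : bpartition r) : bpartition r :=
  BPartition (shift_sorted lam).

Definition Delta r (lam : bpartition r) : 'B_r :=
  \det (\matrix_(i < r, j < r) h r ((tnth lam j)%:Z - j%:Z + i%:Z)).

(* A power series in B_r[[t]] is given by its sequence of coefficients. *)
Definition u r (j : int) : nat -> 'B_r :=
  fun n => (n`!%:R^-1 : rat) *: h r (n%:Z + j).

(* a_n, when phi = \sum_n a_n t^n / n! *)
Definition egf_coef r (phi : nat -> 'B_r) (n : nat) : 'B_r := phi n *+ n`!.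

Definition U r (k : nat) (phi : nat -> 'B_r) : 'B_r :=
  egf_coef phi k + \sum_(1 <= i < k.+1) (-1) ^+ i * e r i * egf_coef phi (k - i).

(* The symbol u_(i_0) /\ u_(i_1) /\ ... with i_m = wedge_idx m. Since symbols
   alternate, those with strictly decreasing indices form a Q-basis of the
   semi-infinite exterior space; only these are considered. The field wedge_thr
   is any rank from which the indices are consecutive. *)
Record wedge := Wedge {
  wedge_idx :> nat -> int;
  wedge_thr : nat;
  wedge_decr : forall m, wedge_idx m.+1 < wedge_idx m;
  wedge_tail : forall m, (wedge_thr <= m)%N -> wedge_idx m.+1 = wedge_idx m - 1
}.

Definition wedge_sum := seq (rat * wedge).

Section Phi.
Variables (r : nat) (i : int) (lam : bpartition r).

(* nth 0 lam m is 0 for m >= r *)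
Definition Phi_idx (m : nat) : int := i - m%:Z + (nth 0%N lam m)%:Z.

Lemma Phi_decr m : Phi_idx m.+1 < Phi_idx m.
Proof.
have le_lam : (nth 0 lam m.+1 <= nth 0 lam m)%N.
  have [ltm|lem] := ltnP m.+1 r; last by rewrite nth_default ?size_tuple.
  by apply: (sortedP 0%N (part_sorted lam)); rewrite size_tuple.
rewrite /Phi_idx; lia.
Qed.

Lemma Phi_tail m : (r <= m)%N -> Phi_idx m.+1 = Phi_idx m - 1.
Proof.
by move=> lem; rewrite /Phi_idx !nth_default ?size_tuple 1?leqW //; lia.
Qed.

Definition Phi : wedge := Wedge Phi_decr Phi_tail.

End Phi.

Section Omit.
Variables (m : nat) (alpha : wedge).

Definition omit_idx (p : nat) : int := alpha (bump m p).

Lemma omit_decr p : omit_idx p.+1 < omit_idx p.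
Proof.
rewrite /omit_idx /bump; have := wedge_decr alpha p.
have := wedge_decr alpha p.+1.
by case: (leqP m p); case: (leqP m p.+1) => /=; rewrite ?add0n ?add1n //; lia.
Qed.

Lemma omit_tail p :
  (maxn (wedge_thr alpha) m <= p)%N -> omit_idx p.+1 = omit_idx p - 1.
Proof.
rewrite geq_max /omit_idx /bump => /andP[le_thr le_m].
by rewrite le_m (leqW le_m) wedge_tail // leqW.
Qed.

(* alpha with its factor of rank m omitted *)
Definition omit : wedge := Wedge omit_decr omit_tail.

End Omit.

(* The index i can only occur in alpha at a rank smaller than this bound. *)
Definition rank_bound (i : int) (alpha : wedge) : nat :=
  (wedge_thr alpha + `|alpha (wedge_thr alpha) - i|).+1.

Lemma rank_boundP i (alpha : wedge) m : alpha m = i -> (m < rank_bound i alpha)%N.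
Proof.
have tailE d : alpha (wedge_thr alpha + d)%N = alpha (wedge_thr alpha) - d%:Z.
  elim: d => [|d IHd]; first by rewrite addn0 subr0.
  by rewrite addnS wedge_tail ?leq_addr // IHd; lia.
move=> <-; rewrite /rank_bound ltnS.
have [/ltnW le_m|le_m] := ltnP m (wedge_thr alpha).
  exact: leq_trans (leq_addr _ _).
by have := tailE (m - wedge_thr alpha)%N; rewrite subnKC // => ->; lia.
Qed.

(* contraction with the dual vector of u_i *)
Definition contract (i : int) (alpha : wedge) : wedge_sum :=
  [seq ((-1) ^+ m, omit m alpha) | m <- iota 0 (rank_bound i alpha) & alpha m == i].

(* [alpha], with k = wedge_thr alpha; if i_m = - m for all large m, then this
   holds for all m >= wedge_thr alpha. Other monomials get the value 0, which is
   never used. *)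
Definition bracket r (alpha : wedge) : 'B_r :=
  let k := wedge_thr alpha in
  if alpha k == - k%:Z then \det (\matrix_(a < k, b < k) U a (u r (alpha b)))
  else 0.

Definition bracket_sum r (x : wedge_sum) : 'B_r :=
  \sum_(t <- x) t.1 *: bracket r t.2.

(* A formal series \sum_n f_n z^n in B_r[[z, z^-1]] is the function f. *)
Definition is_dual_vertex_operator r (Gamma : 'B_r -> int -> 'B_r) : Prop :=
  (forall n : int, linear (fun p => Gamma p n)) /\
  (forall (lam : bpartition r) (i : int),
     Gamma (Delta lam) (- i) = bracket_sum r (contract i (Phi 1 lam))).

(* B_r[z, z^-1] is seen inside the fraction field of B_r[z]. *)
Notation "'K_ r" := {fraction {poly 'B_r}}
  (at level 8, r at level 2, format "''K_' r").

Definition zvar r : 'K_r := tofrac 'X.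
Definition cst r (c : 'B_r) : 'K_r := tofrac c%:P.

(* The formal series \sum_n f_n z^n has finitely many nonzero terms, and is the
   Laurent polynomial x. *)
Definition is_laurent r (f : int -> 'B_r) (x : 'K_r) : Prop :=
  exists N : nat,
    (forall n : int, (N < `|n|)%N -> f n = 0) /\
    x = \sum_(k < N.*2.+1) cst (f (k%:Z - N%:Z)) * zvar r ^ (k%:Z - N%:Z).

(* multiplication by z in B_r[[z, z^-1]] *)
Definition zmul r (f : int -> 'B_r) : int -> 'B_r := fun n => f (n - 1).

(* Main.v *)
(* Contracting Phi_(1, lambda) with the dual of its factor of rank m gives one
   term (-1)^m z^(m - lambda_(m+1)). Its bracket is det (U_a(u_(i_b))), in which
   U_a(u_j) = sum_i (-1)^i e_i h_(a-i+j), so that a unitriangular row operation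
   turns it into det (h_(a + i_b)). For m < r the last column is then the last
   basis vector, which leaves the minor of the Laplace expansion along the row of
   powers of z. For m = r the bracket is Delta_(lambda + (1^r)). For m > r the
   last row of (U_a(u_(i_b))) vanishes because E_r(t) * sum_n h_n t^n = 1. *)
Require Import Defs.
From mathcomp Require Import all_boot all_order all_algebra.
From mathcomp.multinomials Require Import mpoly.
From mathcomp Require Import zify.
Import GRing.Theory.
Local Open Scope ring_scope.

Lemma h_neg (r : nat) (n : int) : n < 0 -> h r n = 0.
Proof. by case: n. Qed.

Lemma coef_E (r k : nat) : (E r)`_k = (-1) ^+ k * e r k.
Proof.
rewrite coef_poly; case: ltnP => // lt_rk.
by case: k lt_rk => // k lt_rk /=; rewrite insubF ?mulr0 //; lia.
Qed.

Lemma U_u (r a : nat) (j : int) :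
  U a (u r j) = \sum_(i < a.+1) (E r)`_i * h r (a%:Z - i%:Z + j).
Proof.
have egfE n : egf_coef (u r j) n = h r (n%:Z + j).
  rewrite /egf_coef /u -scaler_nat scalerA mulfV ?scale1r //.
  by rewrite Num.Theory.pnatr_eq0 -lt0n fact_gt0.
rewrite big_ord_recl {1}coef_E mulr1 mul1r subr0 /U egfE; congr (_ + _).
rewrite big_add1 big_mkord; apply: eq_bigr => i _.
by rewrite egfE coef_E -subzn.
Qed.

Lemma det_U_u (r k : nat) (j : nat -> int) :
  \det (\matrix_(a < k, b < k) U a (u r (j b)))
  = \det (\matrix_(a < k, b < k) h r (a%:Z + j b)).
Proof.
pose L := \matrix_(a < k, c < k) (if (c <= a)%N then (E r)`_(a - c) else 0).
pose M := \matrix_(a < k, b < k) h r (a%:Z + j b).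
have -> : \matrix_(a < k, b < k) U a (u r (j b)) = L *m M.
  (* Substituting c = a - i turns [U_u] into an entry of [L *m M]; the terms with c > a are padded
     by the zeros of [L]. *)
  apply/matrixP=> a b; rewrite !mxE U_u (reindex_inj rev_ord_inj) /=.
  rewrite (big_ord_widen k (fun c => (E r)`_(a.+1 - c.+1)
    * h r (a%:Z - (a.+1 - c.+1)%:Z + j b))) // big_mkcond.
  apply: eq_bigr => c _; rewrite !mxE ltnS subSS; case: leqP => [le_ca|_].
    by congr (_ * h _ _); lia.
  by rewrite mul0r.
rewrite det_mulmx det_trig; last first.
  by apply/is_trig_mxP=> a c lt_ac; rewrite mxE leqNgt lt_ac.
by rewrite big1 ?mul1r // => a _; rewrite mxE leqnn subnn coef_E mulr1.
Qed.

(** The sum in [U_u] is the coefficient of t^(a+j) in E_r(t) * (sum_n h_n t^n) = 1, truncated at i =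
    a. For a >= r the truncation loses nothing, and a + j > 0 makes this coefficient zero. *)
Lemma U_u_eq0 (r a : nat) (j : int) : (r <= a)%N -> - a%:Z < j ->
  U a (u r j) = 0.
Proof.
move=> le_ra lt_aj; rewrite U_u.
have [n def_n] : exists n : nat, a%:Z + j = n.+1%:Z.
  by exists (absz (a%:Z + j - 1)%R); lia.
have E_eq0 i : (r < i)%N -> (E r)`_i = 0.
  by move=> lt_ri; rewrite coef_poly ltnS leqNgt lt_ri.
pose F i := (E r)`_i * h r (a%:Z - i%:Z + j).
have sumE m : (r < m)%N -> \sum_(i < m) F i = \sum_(i < r.+1) F i.
  move=> lt_rm; rewrite [RHS](big_ord_widen m F) // [RHS]big_mkcond.
  by apply: eq_bigr => i _; case: ltnP => // lt_ri; rewrite /F E_eq0 ?mul0r.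
(* A range of length r + n + 3 covers both the degree of E_r and the sum in [E_mul_h]; past i = n +
   1 the index of [h] is negative. *)
rewrite -[LHS]/(\sum_(i < a.+1) F i) sumE // -(sumE (r.+1 + n.+2)%N) ?leq_addr //.
rewrite -[RHS](E_mul_h r n.+1) addnC (big_ord_widen (n.+2 + r.+1)
  (fun i => (E r)`_i * h r (n.+1 - i)%N)) ?leq_addr // [RHS]big_mkcond.
apply: eq_bigr => i _; rewrite /F; case: ltnP => le_in.
  by congr (_ * h _ _); lia.
by rewrite h_neg ?mulr0 //; lia.
Qed.

Section OmitPhi.
Variables (r : nat) (lam : bpartition r).

Lemma bracket_omit_Phi (m : nat) :
  bracket r (omit m (Phi 1 lam)) = \det (\matrix_(a < maxn r m, b < maxn r m)
    U a (u r (1 - (bump m b)%:Z + (nth 0%N lam (bump m b))%:Z))).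
Proof.
(* Past the omission ranks move by one, so rank k = [maxn r m] carries 1 - (k + 1) = - k, as the
   test in [bracket] requires. *)
rewrite /bracket /= ifT // /omit_idx /= /Phi_idx /bump leq_maxr.
by rewrite nth_default ?size_tuple; lia.
Qed.

Lemma bracket_omit_Phi_gt (m : nat) : (r < m)%N ->
  bracket r (omit m (Phi 1 lam)) = 0.
Proof.
move=> lt_rm; rewrite bracket_omit_Phi (maxn_idPr (ltnW lt_rm)).
case: m lt_rm => // m lt_rm; rewrite (expand_det_row _ ord_max).
(* All columns b <= m precede the omitted rank, so their indices are at least 1 - b > - m. *)
apply: big1 => b _; rewrite mxE U_u_eq0 ?mul0r //=.
by rewrite /bump leqNgt ltn_ord; have := ltn_ord b; lia.
Qed.

Lemma bracket_omit_Phi_eq : bracket r (omit r (Phi 1 lam)) = Delta (shift lam).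
Proof.
rewrite bracket_omit_Phi maxnn
  (det_U_u r r (fun b => 1 - (bump r b)%:Z + (nth 0%N lam (bump r b))%:Z)).
congr (\det _); apply/matrixP=> a b; rewrite !mxE tnth_map (tnth_nth 0%N).
by rewrite /bump leqNgt ltn_ord add0n; congr h; lia.
Qed.

(** The range becomes independent of i: no rank from [rank_bound] on carries the index i, and
    omissions at ranks above r have zero bracket. *)
Lemma contract_Phi (i : int) :
  bracket_sum r (contract i (Phi 1 lam)) =
  \sum_(m < r.+1 | Phi_idx 1 lam m == i)
     (-1) ^+ m * bracket r (omit m (Phi 1 lam)).
Proof.
rewrite /bracket_sum /contract big_map big_filter.
set K := rank_bound _ _.
pose F m := (-1) ^+ m * bracket r (omit m (Phi 1 lam)).
transitivity (\sum_(0 <= m < K + r.+1 | Phi_idx 1 lam m == i) F m).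
  rewrite -[iota 0 K]/(index_iota 0 K) (big_nat_widen 0 K (K + r.+1)) ?leq_addr //.
  apply: congr_big => // m; last by rewrite /= -signr_odd scaler_sign /F -signr_odd mulr_sign.
  rewrite /=; case: eqP => //= /(@rank_boundP i (Phi 1 lam)).
  by rewrite -/K => ->.
rewrite -[RHS](big_mkord (fun m => Phi_idx 1 lam m == i) F).
rewrite [RHS](big_nat_widen 0 r.+1 (K + r.+1)) ?leq_addl //.
rewrite [LHS]big_mkcond [RHS]big_mkcond; apply: eq_bigr => m _.
case: eqP => //= _; case: ltnP => // lt_rm.
by rewrite /F bracket_omit_Phi_gt ?mulr0.
Qed.

End OmitPhi.

Lemma bracket_omit_Phi_lt (r : nat) (lam : bpartition r.+1) (m : 'I_r.+1) :
  bracket r.+1 (omit m (Phi 1 lam)) = \det (\matrix_(a < r, b < r)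
    h r.+1 ((tnth lam (lift m b))%:Z - (lift m b)%:Z + a.+1%:Z)).
Proof.
rewrite bracket_omit_Phi (maxn_idPl (ltnW (ltn_ord m))) (det_U_u r.+1 r.+1
  (fun b => 1 - (bump m b)%:Z + (nth 0%N lam (bump m b))%:Z)).
have le_mr : (m <= r)%N by rewrite -ltnS.
(* The last factor has index 1 - (r + 1) = - r, so its column consists of the h_(a - r), and only
   h_0 = 1 survives. *)
rewrite (expand_det_col _ ord_max) (bigD1 ord_max) //= big1 => [|a]; last first.
  rewrite -val_eqE /= => ne_ar; rewrite mxE h_neg ?mul0r //= /bump le_mr.
  by rewrite nth_default ?size_tuple //; have := ltn_ord a; lia.
rewrite mxE /= /bump le_mr nth_default ?size_tuple // addr0.
have -> : r%:Z + (1 - (true + r)%N%:Z + 0%:Z) = 0 by lia.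
rewrite mul1r /cofactor addnn -signr_odd odd_double mul1r.
congr (\det _); apply/matrixP=> a b; rewrite !mxE (tnth_nth 0%N) /= /bump.
by rewrite [(r <= a)%N]leqNgt [(r <= b)%N]leqNgt !ltn_ord !add0n; congr h; lia.
Qed.

Lemma is_laurent_sum (r d : nat) (f : int -> 'B_r) (g : 'I_d -> int)
    (c : 'I_d -> 'B_r) :
    (forall n, f n = \sum_(m < d | g m == n) c m) ->
  is_laurent f (\sum_(m < d) cst (c m) * zvar r ^ g m).
Proof.
(* The sum of all [|g m|] serves as a common bound on the exponents, which may coincide. *)
move=> fE; pose N := (\sum_(m < d) `|g m|)%N; exists N.
have leN m : (`|g m| <= N)%N by rewrite /N (bigD1 m) //= leq_addr.
split=> [n ltNn|].
  rewrite fE big_pred0 // => m; apply: contraTF ltNn => /eqP <-.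
  by rewrite -leqNgt.
transitivity (\sum_(k < N.*2.+1) \sum_(m < d | g m == k%:Z - N%:Z)
    cst (c m) * zvar r ^ g m); last first.
  apply: eq_bigr => k _; rewrite fE /cst !raddf_sum mulr_suml.
  by apply: eq_bigr => m /eqP ->.
rewrite (exchange_big_dep predT) //=; apply: eq_bigr => m _.
have ltk : (absz (g m + N%:Z)%R < N.*2.+1)%N by have := leN m; lia.
rewrite (big_pred1 (Ordinal ltk)) // => k; rewrite /= -val_eqE /=.
by have := leN m; lia.
Qed.

Theorem lemma7p2 (r : nat) (r_gt0 : (0 < r)%N)
    (Gamma : {mpoly rat[r]} -> int -> {mpoly rat[r]})
    (Gamma_vertex : is_dual_vertex_operator Gamma)
    (lam : bpartition r) :
  is_laurent (zmul (Gamma (Delta lam)))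
    (\det (\matrix_(i < r, j < r)
       (if i == 0%N :> nat then zvar r ^ (j%:Z - (tnth lam j)%:Z)
        else cst (h r ((tnth lam j)%:Z - j%:Z + i%:Z))))
     + (-1) ^+ r * zvar r ^+ r * cst (Delta (shift lam))).
Proof.
case: Gamma_vertex => _ GammaE.
(* The index i = 1 - m + lambda_(m+1) gives z^(-i), and [zmul] raises this exponent by one. *)
pose g (m : nat) : int := m%:Z - (nth 0%N lam m)%:Z.
pose c m := (-1) ^+ m * bracket r (omit m (Phi 1 lam)).
have cstM n (p : 'B_r) : cst ((-1) ^+ n * p) = (-1) ^+ n * cst p.
  by rewrite /cst !rmorphM !rmorph_sign.
have fE n : zmul (Gamma (Delta lam)) n = \sum_(m < r.+1 | g m == n) c m.
  rewrite /zmul -[n - 1]opprK GammaE contract_Phi; apply: eq_bigl => m.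
  by rewrite /Phi_idx /g; lia.
suff -> : \det (\matrix_(i < r, j < r)
       (if i == 0%N :> nat then zvar r ^ (j%:Z - (tnth lam j)%:Z)
        else cst (h r ((tnth lam j)%:Z - j%:Z + i%:Z))))
     + (-1) ^+ r * zvar r ^+ r * cst (Delta (shift lam))
   = \sum_(m < r.+1) cst (c m) * zvar r ^ g m by apply: is_laurent_sum.
rewrite big_ord_recr /=; congr (_ + _); last first.
  rewrite /c /g nth_default ?size_tuple // subr0 bracket_omit_Phi_eq cstM.
  by rewrite -exprnP mulrAC.
case: r r_gt0 Gamma lam GammaE @g @c cstM fE => // r _ Gamma lam _ g c cstM _.
rewrite (expand_det_row _ ord0); apply: eq_bigr => m _.
rewrite mxE /= /g /c -tnth_nth mulrC cstM bracket_omit_Phi_lt; congr (_ * _).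
(* With row 0 deleted the minor has constant entries, so the ring morphisms composing [cst] commute
   with its determinant. *)
rewrite /cofactor add0n /cst -!det_map_mx; congr (_ * \det _).
by apply/matrixP=> a b; rewrite !mxE.
Qed.
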